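(* Let $\mathcal{C}$ be a complete additive category, and let $F:\mathcal{C}\to\mathcal{C}$ be a continuous additive covariant endofunctor (in the sense of the context: $F$ preserves direct limits). Then the direct limit of a direct system $\{M_i,\varphi_{ij}\}_{i,j\in I}$ in $\mathfrak{L}_F(\mathcal{C})$ on the poset $I$ is the object $\varinjlim_{i\in I}M_i=\left(\varinjlim_{i\in I}M_i^n,\ \varinjlim_{i\in I}d^n_{M_i}\right)_{n\in\mathbb{Z}}$ together with morphisms $\alpha_i:=(\alpha_i^n)_{n\in\mathbb{Z}}:M_i\to\varinjlim_{i\in I}M_i$ in $\mathfrak{L}_F(\mathcal{C})$, where for each $n\in\mathbb{Z}$ the direct limit of the direct system $\{M_i^n,\varphi_{ij}^n\}_{i,j\in I}$ in $\mathcal{C}$ is the object $\varinjlim_{i\in I}M_i^n$ together with morphisms $\alpha_i^n:M_i^n\to\varinjlim_{i\in I}M_i^n$, and $\varinjlim_{i\in I}d_{M_i}^n:F\left(\varinjlim_{i\in I}M_i^n\right)\to\varinjlim_{i\in I}M_i^{n+1}$ is the morphism induced by the universal property of limits on $\mathcal{C}$.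
   Context: The category $\mathfrak{L}_F(\mathcal{C})$: an object is a family $M=(M^n,d_M^n)_{n\in\mathbb{Z}}$ of objects $M^n$ of $\mathcal{C}$ and morphisms $d_M^n:F(M^n)\to M^{n+1}$ in $\mathcal{C}$ with $d_M^{n+1}\circ F(d_M^n)=0$ for all $n\in\mathbb{Z}$. A morphism $\varphi:M\to N$ is a family $(\varphi^n:M^n\to N^n)_{n\in\mathbb{Z}}$ of morphisms in $\mathcal{C}$ with $\varphi^{n+1}\circ d_M^n=d_N^n\circ F(\varphi^n)$ for all $n\in\mathbb{Z}$. A category is complete precisely when each family of objects has a product and each pair of parallel arrows has an equalizer. An endofunctor is called continuous here if it preserves direct limits (and cocontinuous if it preserves inverse limits). *)

(* Defs.v *)
From HB Require Import structures.
From mathcomp Require Import all_boot all_order all_algebra.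
From mathcomp Require Import boolp.

Set Implicit Arguments.
Unset Strict Implicit.
Unset Printing Implicit Defensive.

Import GRing.Theory.
Local Open Scope ring_scope.

Declare Scope cat_scope.
Delimit Scope cat_scope with cat.
Local Open Scope cat_scope.

Record category := Category {
  cat_obj :> Type;
  mor : cat_obj -> cat_obj -> Type;
  idm : forall X, mor X X;
  compm : forall X Y Z, mor Y Z -> mor X Y -> mor X Z;
  comp1m : forall X Y (f : mor X Y), compm (idm Y) f = f;
  compm1 : forall X Y (f : mor X Y), compm f (idm X) = f;
  compmA : forall X Y Z T (h : mor Z T) (g : mor Y Z) (f : mor X Y),
    compm h (compm g f) = compm (compm h g) f
}.

Arguments mor {c} X Y.
Arguments idm {c} X : simpl never.
Arguments compm {c X Y Z} g f : simpl never.
Notation "g ∘ f" := (compm g f) (at level 40, left associativity) : cat_scope.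

Record functor (C D : category) := Functor {
  fobj :> C -> D;
  fmap : forall X Y : C, mor X Y -> mor (fobj X) (fobj Y);
  fmap1 : forall X : C, fmap (idm X) = idm (fobj X);
  fmapM : forall (X Y Z : C) (g : mor Y Z) (f : mor X Y),
    fmap (g ∘ f) = fmap g ∘ fmap f
}.

Arguments fmap {C D} F {X Y} f : rename.

Section Limits.
Variable C : category.

Definition is_product (A : Type) (X : A -> C) (P : C)
    (p : forall a, mor P (X a)) : Prop :=
  forall (Y : C) (q : forall a, mor Y (X a)),
    exists! u : mor Y P, forall a, p a ∘ u = q a.

Definition is_coproduct (A : Type) (X : A -> C) (S : C)
    (s : forall a, mor (X a) S) : Prop :=
  forall (Y : C) (q : forall a, mor (X a) Y),
    exists! u : mor S Y, forall a, u ∘ s a = q a.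

Definition is_equalizer (X Y : C) (f g : mor X Y) (E : C) (e : mor E X) : Prop :=
  f ∘ e = g ∘ e /\
  forall (Z : C) (h : mor Z X), f ∘ h = g ∘ h ->
    exists! u : mor Z E, e ∘ u = h.

Definition is_zero_object (Z : C) : Prop :=
  forall X : C, (exists! u : mor X Z, True) /\ (exists! u : mor Z X, True).

Definition has_product (A : Type) (X : A -> C) : Prop :=
  exists (P : C) (p : forall a, mor P (X a)), is_product p.

Definition has_coproduct (A : Type) (X : A -> C) : Prop :=
  exists (S : C) (s : forall a, mor (X a) S), is_coproduct s.

Definition complete_category : Prop :=
  (forall (A : Type) (X : A -> C), has_product X) /\
  (forall (X Y : C) (f g : mor X Y),
     exists (E : C) (e : mor E X), is_equalizer f g e).

End Limits.

Record preadditive_category := PreadditiveCategory {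
  pa_obj : Type;
  pa_hom : pa_obj -> pa_obj -> zmodType;
  pa_id : forall X, pa_hom X X;
  pa_comp : forall X Y Z, pa_hom Y Z -> pa_hom X Y -> pa_hom X Z;
  pa_comp1m : forall X Y (f : pa_hom X Y), pa_comp (pa_id Y) f = f;
  pa_compm1 : forall X Y (f : pa_hom X Y), pa_comp f (pa_id X) = f;
  pa_compA : forall X Y Z T (h : pa_hom Z T) (g : pa_hom Y Z) (f : pa_hom X Y),
    pa_comp h (pa_comp g f) = pa_comp (pa_comp h g) f;
  pa_compDl : forall X Y Z (g g' : pa_hom Y Z) (f : pa_hom X Y),
    pa_comp (g + g') f = pa_comp g f + pa_comp g' f;
  pa_compDr : forall X Y Z (g : pa_hom Y Z) (f f' : pa_hom X Y),
    pa_comp g (f + f') = pa_comp g f + pa_comp g f'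
}.

Coercion cat_of_preadditive (C : preadditive_category) : category :=
  @Category (pa_obj C) (fun X Y => pa_hom X Y) (@pa_id C) (@pa_comp C)
    (@pa_comp1m C) (@pa_compm1 C) (@pa_compA C).

Definition addm (C : preadditive_category) (X Y : C) (f g : mor X Y) : mor X Y :=
  (f : pa_hom X Y) + (g : pa_hom X Y).

Definition zerom (C : preadditive_category) (X Y : C) : mor X Y :=
  (0 : pa_hom X Y).

Record additive_category := AdditiveCategory {
  ac_preadditive :> preadditive_category;
  ac_zero : exists Z : ac_preadditive, is_zero_object Z;
  ac_product : forall (n : nat) (X : 'I_n -> ac_preadditive), has_product X;
  ac_coproduct : forall (n : nat) (X : 'I_n -> ac_preadditive), has_coproduct X
}.

Definition additive_functor (C D : preadditive_category) (F : functor C D) : Prop :=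
  forall (X Y : C) (f g : mor X Y), fmap F (addm f g) = addm (fmap F f) (fmap F g).

(* The index poset is not assumed to be directed. *)
Record direct_system (d : Order.disp_t) (I : porderType d) (C : category) :=
  DirectSystem {
  ds_obj :> I -> C;
  ds_map : forall i j : I, (i <= j)%O -> mor (ds_obj i) (ds_obj j);
  ds_map1 : forall (i : I) (h : (i <= i)%O), ds_map h = idm (ds_obj i);
  ds_mapM : forall (i j k : I) (hij : (i <= j)%O) (hjk : (j <= k)%O) (hik : (i <= k)%O),
    ds_map hjk ∘ ds_map hij = ds_map hik
}.

Section DirectLimits.
Variables (d : Order.disp_t) (I : porderType d).

Definition is_cocone (C : category) (M : direct_system I C) (X : C)
    (f : forall i, mor (M i) X) : Prop :=
  forall (i j : I) (h : (i <= j)%O), f j ∘ ds_map M h = f i.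

Definition is_direct_limit (C : category) (M : direct_system I C) (L : C)
    (alpha : forall i, mor (M i) L) : Prop :=
  is_cocone alpha /\
  forall (X : C) (f : forall i, mor (M i) X), is_cocone f ->
    exists! u : mor L X, forall i, u ∘ alpha i = f i.

Section Image.
Variables (C D : category) (F : functor C D) (M : direct_system I C).

Lemma ds_image_map1 (i : I) (h : (i <= i)%O) :
  fmap F (ds_map M h) = idm (F (M i)).
Proof. by rewrite ds_map1 fmap1. Qed.

Lemma ds_image_mapM (i j k : I) (hij : (i <= j)%O) (hjk : (j <= k)%O)
    (hik : (i <= k)%O) :
  fmap F (ds_map M hjk) ∘ fmap F (ds_map M hij) = fmap F (ds_map M hik).
Proof. by rewrite -fmapM (ds_mapM M hij hjk hik). Qed.

Definition ds_image : direct_system I D :=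
  @DirectSystem d I D (fun i => F (M i)) (fun i j h => fmap F (ds_map M h))
    ds_image_map1 ds_image_mapM.

End Image.
End DirectLimits.

Definition preserves_direct_limits (C D : category) (F : functor C D) : Prop :=
  forall (d : Order.disp_t) (I : porderType d) (M : direct_system I C)
         (L : C) (alpha : forall i, mor (M i) L),
    is_direct_limit alpha ->
    is_direct_limit (M := ds_image F M) (fun i => fmap F (alpha i)).

Section LF.
Variables (C : preadditive_category) (F : functor C C).

Record LF_obj := LFObj {
  lf_obj :> int -> C;
  lf_d : forall n : int, mor (F (lf_obj n)) (lf_obj (n + 1));
  lf_dd : forall n : int, lf_d (n + 1) ∘ fmap F (lf_d n) = zerom _ _
}.

Record LF_hom (M N : LF_obj) := LFHom {
  lf_map :> forall n : int, mor (M n) (N n);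
  lf_mapd : forall n : int, lf_map (n + 1) ∘ lf_d M n = lf_d N n ∘ fmap F (lf_map n)
}.

Lemma LF_hom_eq (M N : LF_obj) (f g : LF_hom M N) :
  (forall n, f n = g n) -> f = g.
Proof.
case: f g => [f hf] [g hg] /= fg.
have {}fg : f = g by apply: functional_extensionality_dep.
by case: _ / fg in hg *; congr LFHom; apply: Prop_irrelevance.
Qed.

Lemma LF_id_subproof (M : LF_obj) (n : int) :
  idm (M (n + 1)) ∘ lf_d M n = lf_d M n ∘ fmap F (idm (M n)).
Proof. by rewrite comp1m fmap1 compm1. Qed.

Definition LF_id (M : LF_obj) : LF_hom M M := LFHom (LF_id_subproof M).

Lemma LF_comp_subproof (M N P : LF_obj) (g : LF_hom N P) (f : LF_hom M N) (n : int) :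
  (g (n + 1) ∘ f (n + 1)) ∘ lf_d M n = lf_d P n ∘ fmap F (g n ∘ f n).
Proof. by rewrite -compmA lf_mapd compmA lf_mapd -compmA -fmapM. Qed.

Definition LF_comp (M N P : LF_obj) (g : LF_hom N P) (f : LF_hom M N) : LF_hom M P :=
  LFHom (LF_comp_subproof g f).

Lemma LF_comp1m (M N : LF_obj) (f : LF_hom M N) : LF_comp (LF_id N) f = f.
Proof. by apply: LF_hom_eq => n; apply: comp1m. Qed.

Lemma LF_compm1 (M N : LF_obj) (f : LF_hom M N) : LF_comp f (LF_id M) = f.
Proof. by apply: LF_hom_eq => n; apply: compm1. Qed.

Lemma LF_compA (M N P Q : LF_obj) (h : LF_hom P Q) (g : LF_hom N P) (f : LF_hom M N) :
  LF_comp h (LF_comp g f) = LF_comp (LF_comp h g) f.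
Proof. by apply: LF_hom_eq => n; apply: compmA. Qed.

Definition LF : category :=
  @Category LF_obj LF_hom LF_id LF_comp LF_comp1m LF_compm1 LF_compA.

Definition LF_degree (n : int) : functor LF C :=
  @Functor LF C (fun M : LF_obj => M n) (fun (M N : LF_obj) (f : LF_hom M N) => f n)
    (fun _ => erefl) (fun _ _ _ _ _ => erefl).

End LF.

Arguments LFObj {C F} lf_obj lf_d lf_dd.
Arguments LFHom {C F M N} lf_map lf_mapd.

(* Main.v *)
Require Import Defs.
From mathcomp Require Import all_boot all_order all_algebra.
From mathcomp Require Import boolp.

(** A morphism out of a direct limit is determined by its composites with the
structure morphisms, so everything reduces to checks at the stages [M i].

Since [F] preserves direct limits, the [fmap F (alpha n i)] form a direct limit
cocone on the objects [F (M i n)].  The morphisms [alpha (n + 1) i ∘ lf_d (M i) n]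
form a cocone on the same system, because the transition maps of [M] commute
with the differentials; [dL n] is the morphism that it induces.

The identity [dL (n + 1) ∘ fmap F (dL n) = 0] is an equality of morphisms out
of [F (F (L n))].  Applying preservation twice makes this object a direct limit
as well, and precomposing with [fmap F (fmap F (alpha n i))] turns the left-hand
side into [alpha (n + 1 + 1) i] precomposed with
[lf_d (M i) (n + 1) ∘ fmap F (lf_d (M i) n)], which is zero.

For the universal property, a cocone from [M] to [X] in [LF F] induces one
morphism [L n -> X n] in each degree.  These commute with the differentials
because both composites agree after each [fmap F (alpha n i)], and uniqueness
holds degree by degree. *)

Set Implicit Arguments.
Unset Strict Implicit.
Unset Printing Implicit Defensive.

Local Open Scope ring_scope.
Local Open Scope cat_scope.

Section DirectLimitFacts.
Variables (d : Order.disp_t) (I : porderType d) (C : category).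
Variables (M : direct_system I C) (L : C) (alpha : forall i, mor (M i) L).
Hypothesis L_lim : is_direct_limit alpha.

Lemma direct_limit_ext (X : C) (u v : mor L X) :
  (forall i, u ∘ alpha i = v ∘ alpha i) -> u = v.
Proof.
move=> uv; have [alphaM univ] := L_lim.
have [|w [_ w_uniq]] := univ X (fun i => v ∘ alpha i).
  by move=> i j h; rewrite -compmA alphaM.
by rewrite -(w_uniq u uv) (w_uniq v).
Qed.

(** Turning the mere existence of the induced morphism into data is what allows
one to be picked for all degrees at once. *)
Lemma direct_limit_desc (X : C) (f : forall i, mor (M i) X) :
  is_cocone f -> {u : mor L X | forall i, u ∘ alpha i = f i}.
Proof.
move=> fM; apply: cid; have [_ univ] := L_lim.
by have [u [uf _]] := univ X f fM; exists u.
Qed.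

End DirectLimitFacts.

Section PreadditiveFacts.
Variable C : preadditive_category.

Lemma comp0m (X Y Z : C) (f : mor X Y) : zerom Y Z ∘ f = zerom X Z.
Proof.
apply: (@GRing.addrI (pa_hom X Z) (zerom Y Z ∘ f)).
by rewrite -[LHS]pa_compDl /zerom !GRing.addr0.
Qed.

Lemma compm0 (X Y Z : C) (g : mor Y Z) : g ∘ zerom X Y = zerom X Z.
Proof.
apply: (@GRing.addrI (pa_hom X Z) (g ∘ zerom X Y)).
by rewrite -[LHS]pa_compDr /zerom !GRing.addr0.
Qed.

End PreadditiveFacts.

Section LFFacts.
Variables (C : preadditive_category) (F : functor C C).
Variables (d : Order.disp_t) (I : porderType d) (M : direct_system I (LF F)).

(** This is the cocone that induces the differential of the direct limit. *)
Lemma lf_d_cocone (n : int) (L : C)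
    (alpha : forall i, mor (ds_image (LF_degree F (n + 1)) M i) L) :
  is_cocone alpha ->
  is_cocone (M := ds_image F (ds_image (LF_degree F n) M))
    (fun i => alpha i ∘ lf_d (M i) n).
Proof.
move=> alphaM i j h /=.
by rewrite -compmA -lf_mapd compmA [X in X ∘ _](alphaM i j h).
Qed.

Lemma LF_degree_cocone (X : LF F) (f : forall i, mor (M i) X) (n : int) :
  is_cocone f ->
  is_cocone (M := ds_image (LF_degree F n) M) (fun i => lf_map (f i) n).
Proof. by move=> fM i j h /=; rewrite -(fM i j h). Qed.

End LFFacts.

Theorem theorem3p7 (C : additive_category) (F : functor C C)
    (C_complete : complete_category C) (F_additive : additive_functor F)
    (F_continuous : preserves_direct_limits F)
    (d : Order.disp_t) (I : porderType d) (M : direct_system I (LF F))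
    (L : int -> C)
    (alpha : forall (n : int) (i : I), mor (ds_image (LF_degree F n) M i) (L n))
    (L_lim : forall n : int, is_direct_limit (alpha n)) :
  exists dL : forall n : int, mor (F (L n)) (L (n + 1)),
    (forall n : int,
       unique (fun u : mor (F (L n)) (L (n + 1)) =>
                 forall i : I, u ∘ fmap F (alpha n i) = alpha (n + 1) i ∘ lf_d (M i) n)
              (dL n)) /\
    exists (dL_dL : forall n : int, dL (n + 1) ∘ fmap F (dL n) = zerom _ _)
           (alpha_d : forall (i : I) (n : int),
              alpha (n + 1) i ∘ lf_d (M i) n = dL n ∘ fmap F (alpha n i)),
      is_direct_limit (M := M) (L := LFObj L dL dL_dL)
        (fun i : I => LFHom (M := M i) (N := LFObj L dL dL_dL)
                            (fun n => alpha n i) (alpha_d i)).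
Proof.
have FL_lim n := F_continuous _ _ _ _ _ (L_lim n).
have FFL_lim n := F_continuous _ _ _ _ _ (FL_lim n).
pose dL n := sval (direct_limit_desc (FL_lim n)
  (lf_d_cocone (proj1 (L_lim (n + 1))))).
have dL_alpha n i : dL n ∘ fmap F (alpha n i) = alpha (n + 1) i ∘ lf_d (M i) n.
  exact: (svalP (direct_limit_desc (FL_lim n) _)).
exists dL; split=> [n|].
  split=> [|u u_alpha]; first exact: dL_alpha.
  by apply: (direct_limit_ext (FL_lim n)) => i; rewrite u_alpha; apply: dL_alpha.
have dL_dL n : dL (n + 1) ∘ fmap F (dL n) = zerom _ _.
  apply: (direct_limit_ext (FFL_lim n)) => i /=.
  rewrite -compmA -fmapM dL_alpha fmapM compmA dL_alpha -compmA lf_dd.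
  by rewrite compm0 comp0m.
exists dL_dL, (fun i n => esym (dL_alpha n i)); split=> [i j h|X f fM].
  by apply: LF_hom_eq => n; apply: (proj1 (L_lim n)).
pose u n := sval (direct_limit_desc (L_lim n) (LF_degree_cocone n fM)).
have u_alpha n i : u n ∘ alpha n i = lf_map (f i) n.
  exact: (svalP (direct_limit_desc (L_lim n) _)).
have u_d n : u (n + 1) ∘ dL n = lf_d X n ∘ fmap F (u n).
  apply: (direct_limit_ext (FL_lim n)) => i /=.
  by rewrite -!compmA -fmapM dL_alpha u_alpha compmA u_alpha lf_mapd.
exists (LFHom (M := LFObj L dL dL_dL) u u_d); split=> [i|v v_alpha].
  by apply: LF_hom_eq => n; apply: u_alpha.
apply: LF_hom_eq => n; apply: (direct_limit_ext (L_lim n)) => i /=.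
by rewrite u_alpha -(v_alpha i).
Qed.
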